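(* Let $n\ge2$ and let $\mathcal{A}$ be one of the real algebras $\langle\mathbf{DS}_n\rangle$, $\langle\mathbf{RS}_n\rangle$, $\langle\mathbf{CS}_n\rangle$. Every algebra automorphism $\phi$ of $\mathcal{A}$ has the form $$\phi(A)=PAP^{-1},\qquad A\in\mathcal{A},$$ in which $P$ is as follows: (1) When $n=2$ and $\mathcal{A}=\langle\mathbf{DS}_2\rangle$, $P\in\left\{I_2,\begin{pmatrix}1&0\\ 0&-1\end{pmatrix}\right\}$. The two automorphisms are the identity map and the map $$\phi\left(\begin{pmatrix}a & b \\ b & a\end{pmatrix}\right)=\begin{pmatrix}a & -b \\ -b & a\end{pmatrix},\qquad a,b\in\mathbb{R}.$$ (2) When $n\ne2$ or $\mathcal{A}\ne\langle\mathbf{DS}_2\rangle$, $P\in\mathcal{A}$ is invertible. Moreover, in this case, when $\mathcal{A}=\langle\mathbf{DS}_n\rangle$, $P$ can be chosen from the invertible matrices in $\mathbf{DS}_n$.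
   Context: $\mathbf{DS}_n$, $\mathbf{RS}_n$, $\mathbf{CS}_n$ are the sets of $n\times n$ doubly stochastic, row stochastic, and column stochastic matrices (real, entrywise nonnegative, with all row and column sums, all row sums, or all column sums, respectively, equal to $1$). $\langle\cdot\rangle$ denotes the real linear span. With $e=(1,\ldots,1)^t\in\mathbb{R}^n$: $\langle\mathbf{DS}_n\rangle=\{A\in M_n(\mathbb{R}):Ae=ce,\ e^tA=ce^t,\ c\in\mathbb{R}\}$, $\langle\mathbf{RS}_n\rangle=\{A\in M_n(\mathbb{R}):Ae=ce,\ c\in\mathbb{R}\}$, $\langle\mathbf{CS}_n\rangle=\{A\in M_n(\mathbb{R}):e^tA=ce^t,\ c\in\mathbb{R}\}$; these are unital $\mathbb{R}$-algebras under matrix multiplication, and automorphisms are $\mathbb{R}$-algebra automorphisms. *)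

(* Defs.v *)
From HB Require Import structures.
From mathcomp Require Import all_boot all_order all_algebra.
From mathcomp Require Import mathcomp_extra boolp classical_sets functions reals.
Set Implicit Arguments.
Unset Strict Implicit.
Unset Printing Implicit Defensive.
Import Order.TTheory GRing.Theory Num.Theory.
Local Open Scope classical_set_scope.
Local Open Scope ring_scope.

Definition row_stochastic (R : realType) (n : nat) : set 'M[R]_n :=
  [set A | (forall i j, 0 <= A i j) /\ (forall i, \sum_j A i j = 1)].

Definition col_stochastic (R : realType) (n : nat) : set 'M[R]_n :=
  [set A | (forall i j, 0 <= A i j) /\ (forall j, \sum_i A i j = 1)].

Definition doubly_stochastic (R : realType) (n : nat) : set 'M[R]_n :=
  [set A | [/\ forall i j, 0 <= A i j, forall i, \sum_j A i j = 1
             & forall j, \sum_i A i j = 1]].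

Arguments row_stochastic : clear implicits.
Arguments col_stochastic : clear implicits.
Arguments doubly_stochastic : clear implicits.

(* MathComp's <<X>>%VS is the span of a finite sequence; the span of an
   arbitrary set is the union of the spans of its finite subfamilies. *)
Definition lin_span (R : realType) (n : nat) (S : set 'M[R]_n) : set 'M[R]_n :=
  [set A | exists2 X : seq 'M[R]_n, [set` X] `<=` S & A \in <<X>>%VS].

(* An automorphism of the algebra carried by a set Alg of matrices is given by
   a function on all of 'M[R]_n; only its values on Alg matter. *)
Definition alg_automorphism (R : realType) (n : nat)
    (Alg : set 'M[R]_n) (phi : 'M[R]_n -> 'M[R]_n) : Prop :=
  [/\ set_bij Alg Alg phi,
      forall A B, Alg A -> Alg B -> phi (A + B) = phi A + phi B,
      forall (c : R) A, Alg A -> phi (c *: A) = c *: phi A,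
      forall A B, Alg A -> Alg B -> phi (A *m B) = phi A *m phi B
    & phi 1%:M = 1%:M].

Definition conj_on (R : realType) (n : nat) (Alg : set 'M[R]_n)
    (phi : 'M[R]_n -> 'M[R]_n) (P : 'M[R]_n) : Prop :=
  P \in unitmx /\ forall A, Alg A -> phi A = P *m A *m invmx P.

Definition mx22 (R : realType) (a b c d : R) : 'M[R]_2 :=
  \matrix_(i < 2, j < 2)
    if i == ord0 then (if j == ord0 then a else b)
    else (if j == ord0 then c else d).

(* Main.v *)
Require Import Defs.
From HB Require Import structures.
From mathcomp Require Import all_boot all_order all_algebra.
From mathcomp Require Import mathcomp_extra boolp classical_sets functions reals.
Set Implicit Arguments.
Unset Strict Implicit.
Unset Printing Implicit Defensive.
Import Order.TTheory GRing.Theory Num.Theory.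
Local Open Scope classical_set_scope.
Local Open Scope ring_scope.


(** Each of the three spans is cut out by linear conditions on row and column
    sums: every matrix with constant sums is a combination of the averaging
    matrix [J] (all entries [1/n]) and a small perturbation of it
    ([span_rowP], [span_colP], [span_doublyP]).

    The proof that automorphisms are inner is the classical argument for full
    matrix algebras, run inside a smaller algebra. Let [e] be the all-ones
    vector and [y] a nonzero row with [y e = 0]. For the row stochastic span,
    the matrices [v y] all lie in the algebra, and [P v := phi (v y) z]
    satisfies [P A = phi A P] ([intertwiner]). Choosing [z] with
    [phi (e y) z <> 0] makes [P] invertible, since the only proper nonzero
    invariant subspace of the algebra is the line of [e]; and [P] preserves this
    line because its vectors are the only common eigenvectors
    ([row_aut_inner]). The column stochastic span follows by transposition
    ([col_aut_inner]).

    The doubly stochastic span is the product of the line of [J] and of the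
    matrix algebra acting on the vectors of zero sum. When [n >= 3] the second
    factor acts on a space of dimension at least 2, so that [phi] must fix [J]
    ([doubly_aut_avg]). The same construction, restricted to vectors of zero
    sum, gives an intertwiner [P0] that vanishes on the line of [e]; then
    [J + eps P0] conjugates [A] to [phi A] whatever [eps <> 0] is, and it is
    doubly stochastic for small positive [eps] ([doubly_aut_inner]). When
    [n = 2] both factors are lines and [phi] is determined by the image of the
    swap matrix, which can only be the swap or its opposite
    ([doubly2_aut_id_or_flip]). *)

(** * The three spans as algebras of matrices *)

Definition ones (R : realType) n : 'cV[R]_n := const_mx 1.
Arguments ones : clear implicits.

Definition avg_mx (R : realType) n : 'M[R]_n := n%:R^-1 *: const_mx 1.
Arguments avg_mx : clear implicits.

Lemma ones_neq0 (R : realType) n : ones R n.+1 != 0.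
Proof. by apply/eqP => /colP /(_ ord0) /eqP; rewrite !mxE oner_eq0. Qed.

Lemma mulmx_ones (R : realType) m n (A : 'M[R]_(m, n)) i :
  (A *m ones R n) i 0 = \sum_j A i j.
Proof. by rewrite mxE; apply: eq_bigr => j _; rewrite mxE mulr1. Qed.

Lemma ones_tr_mulmx (R : realType) m n (A : 'M[R]_(m, n)) j :
  ((ones R m)^T *m A) 0 j = \sum_i A i j.
Proof. by rewrite mxE; apply: eq_bigr => i _; rewrite !mxE mul1r. Qed.

Lemma row_sums1P (R : realType) m n (A : 'M[R]_(m, n)) :
  (forall i, \sum_j A i j = 1) <-> A *m ones R n = ones R m.
Proof.
split=> [A1|A1 i]; first by apply/colP => i; rewrite mulmx_ones A1 mxE.
by rewrite -mulmx_ones A1 mxE.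
Qed.

Lemma col_sums1P (R : realType) m n (A : 'M[R]_(m, n)) :
  (forall j, \sum_i A i j = 1) <-> (ones R m)^T *m A = (ones R n)^T.
Proof.
split=> [A1|A1 j]; first by apply/rowP => j; rewrite ones_tr_mulmx A1 !mxE.
by rewrite -ones_tr_mulmx A1 !mxE.
Qed.

Lemma avg_mxE (R : realType) n :
  avg_mx R n = n%:R^-1 *: (ones R n *m (ones R n)^T).
Proof.
by congr (_ *: _); apply/matrixP => i j; rewrite !mxE big_ord1 !mxE mulr1.
Qed.

Lemma avg_mx_ones (R : realType) n : avg_mx R n.+1 *m ones R n.+1 = ones R n.+1.
Proof.
apply/row_sums1P => i; under eq_bigr do rewrite !mxE mulr1.
by rewrite sumr_const card_ord -[_ *+ n.+1]mulr_natl mulfV // pnatr_eq0.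
Qed.

Lemma ones_avg_mx (R : realType) n :
  (ones R n.+1)^T *m avg_mx R n.+1 = (ones R n.+1)^T.
Proof.
apply/col_sums1P => i; under eq_bigr do rewrite !mxE mulr1.
by rewrite sumr_const card_ord -[_ *+ n.+1]mulr_natl mulfV // pnatr_eq0.
Qed.

Lemma mulmx_avg (R : realType) n (A : 'M[R]_n) c :
  A *m ones R n = c *: ones R n -> A *m avg_mx R n = c *: avg_mx R n.
Proof.
by move=> Ae; rewrite avg_mxE -scalemxAr mulmxA Ae -scalemxAl !scalerA mulrC.
Qed.

Lemma avg_mulmx (R : realType) n (A : 'M[R]_n) c :
  (ones R n)^T *m A = c *: (ones R n)^T -> avg_mx R n *m A = c *: avg_mx R n.
Proof.
move=> eA; rewrite avg_mxE -scalemxAl -mulmxA eA -scalemxAr !scalerA.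
by rewrite mulrC.
Qed.

(** The averaging matrix has positive entries, so it stays nonnegative under a
    small perturbation in any direction. This puts matrices with prescribed
    sums into the spans, and makes a conjugating matrix doubly stochastic. *)
Lemma avg_perturb_ge0 (R : realType) n (B : 'M[R]_n) :
  exists2 eps : R, 0 < eps & forall i j, 0 <= (avg_mx R n + eps *: B) i j.
Proof.
case: n B => [|n] B; first by exists 1 => // -[].
pose s := 1 + \sum_i \sum_j `|B i j|.
have s_gt0 : 0 < s.
  by rewrite ltr_pwDl // sumr_ge0 // => i _; rewrite sumr_ge0.
have leBs i j : `|B i j| <= s.
  rewrite /s (bigD1 i) //= (bigD1 j) //=.
  rewrite [leRHS]addrC -!addrA lerDl.
  by rewrite !addr_ge0 ?sumr_ge0 // => k _; rewrite sumr_ge0.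
exists (n.+1%:R^-1 / s) => [|i j]; first by rewrite divr_gt0 ?invr_gt0 ?ltr0Sn.
rewrite !mxE -mulrA -mulrDr mulr_ge0 ?invr_ge0 ?ler0n //.
rewrite -lerBlDl sub0r [leRHS]mulrC ler_pdivlMr // mulN1r.
by rewrite lerNl (le_trans _ (leBs i j)) // -normrN ler_norm.
Qed.

Lemma sub_lin_span (R : realType) n (S : set 'M[R]_n) : S `<=` lin_span S.
Proof.
move=> A SA; exists [:: A]; last by rewrite memv_span ?mem_head.
by move=> B /=; rewrite inE => /eqP ->.
Qed.

Lemma lin_span_min (R : realType) n (S T : set 'M[R]_n) : S `<=` T -> T 0 ->
  (forall A B, T A -> T B -> T (A + B)) ->
  (forall (c : R) A, T A -> T (c *: A)) -> lin_span S `<=` T.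
Proof.
move=> sST T0 TD TZ A [X sXS /(@coord_span _ _ _ (in_tuple X)) ->].
apply: big_ind => // i _; apply: TZ; apply: sST; apply: sXS => /=.
exact: mem_nth.
Qed.

Lemma lin_span_avg (R : realType) n (S : set 'M[R]_n) c (B : 'M[R]_n) :
  S (avg_mx R n) ->
  (forall eps : R, (forall i j, 0 <= (avg_mx R n + eps *: B) i j) ->
     S (avg_mx R n + eps *: B)) ->
  lin_span S (c *: avg_mx R n + B).
Proof.
move=> SJ SB; have [eps eps_gt0 /SB SJB] := avg_perturb_ge0 B.
exists [:: avg_mx R n; avg_mx R n + eps *: B] => [M|] /=.
  by rewrite !inE => /orP[] /eqP ->.
set X := [:: _; _].
have JX : avg_mx R n \in <<X>>%VS by rewrite memv_span ?inE ?eqxx.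
have JBX : avg_mx R n + eps *: B \in <<X>>%VS.
  by rewrite memv_span ?inE ?eqxx ?orbT.
have BX : B \in <<X>>%VS.
  rewrite -(scalerK (lt0r_neq0 eps_gt0) B); apply: memvZ.
  by rewrite -[eps *: B](addKr (avg_mx R n)) memvD ?memvN.
by apply: memvD => //; apply: memvZ.
Qed.

Lemma avg_mx_ge0 (R : realType) n i j : 0 <= avg_mx R n i j.
Proof. by rewrite !mxE mulr1 invr_ge0 ler0n. Qed.

Lemma span_rowP (R : realType) n (A : 'M[R]_n.+1) :
  lin_span (row_stochastic R n.+1) A <->
  exists c, A *m ones R n.+1 = c *: ones R n.+1.
Proof.
split=> [|[c Ae]].
  move: A; apply: lin_span_min => [A [_ /row_sums1P Ae]||A B [c Ac] [d Bd]|c A [d Ad]].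
  - by exists 1; rewrite scale1r.
  - by exists 0; rewrite mul0mx scale0r.
  - by exists (c + d); rewrite mulmxDl Ac Bd scalerDl.
  - by exists (c * d); rewrite -scalemxAl Ad scalerA.
rewrite -[A](subrKC (c *: avg_mx R n.+1)).
have Je := avg_mx_ones R n; apply: lin_span_avg => [|eps ge0].
  by split; [exact: avg_mx_ge0 | exact/row_sums1P].
split=> //; apply/row_sums1P.
by rewrite mulmxDl -(scalemxAl eps) mulmxBl -(scalemxAl c) Je Ae subrr scaler0 addr0.
Qed.

Lemma span_colP (R : realType) n (A : 'M[R]_n.+1) :
  lin_span (col_stochastic R n.+1) A <->
  exists c, (ones R n.+1)^T *m A = c *: (ones R n.+1)^T.
Proof.
split=> [|[c Ae]].
  move: A; apply: lin_span_min => [A [_ /col_sums1P Ae]||A B [c Ac] [d Bd]|c A [d Ad]].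
  - by exists 1; rewrite scale1r.
  - by exists 0; rewrite mulmx0 scale0r.
  - by exists (c + d); rewrite mulmxDr Ac Bd scalerDl.
  - by exists (c * d); rewrite -scalemxAr Ad scalerA.
rewrite -[A](subrKC (c *: avg_mx R n.+1)).
have Je := ones_avg_mx R n; apply: lin_span_avg => [|eps ge0].
  by split; [exact: avg_mx_ge0 | exact/col_sums1P].
split=> //; apply/col_sums1P.
by rewrite mulmxDr -(scalemxAr eps) mulmxBr -(scalemxAr c) Je Ae subrr scaler0 addr0.
Qed.

Lemma span_doublyP (R : realType) n (A : 'M[R]_n.+1) :
  lin_span (doubly_stochastic R n.+1) A <->
  exists c, A *m ones R n.+1 = c *: ones R n.+1 /\
            (ones R n.+1)^T *m A = c *: (ones R n.+1)^T.
Proof.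
split=> [|[c [Ae eA]]].
  move: A; apply: lin_span_min
    => [A [_ /row_sums1P Ae /col_sums1P eA]||A B [c [Ac cA]] [d [Bd dB]]
       |c A [d [Ad dA]]].
  - by exists 1; rewrite !scale1r.
  - by exists 0; rewrite mulmx0 mul0mx !scale0r.
  - by exists (c + d); rewrite mulmxDr mulmxDl Ac Bd cA dB !scalerDl.
  - by exists (c * d); rewrite -scalemxAr -scalemxAl Ad dA !scalerA.
rewrite -[A](subrKC (c *: avg_mx R n.+1)).
have Je := avg_mx_ones R n; have eJ := ones_avg_mx R n.
apply: lin_span_avg => [|eps ge0].
  by split; [exact: avg_mx_ge0 | exact/row_sums1P | exact/col_sums1P].
split=> //; [apply/row_sums1P | apply/col_sums1P].
  by rewrite mulmxDl -(scalemxAl eps) mulmxBl -(scalemxAl c) Je Ae subrr scaler0 addr0.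
by rewrite mulmxDr -(scalemxAr eps) mulmxBr -(scalemxAr c) eJ eA subrr scaler0 addr0.
Qed.

Lemma rank1_span_doubly (R : realType) n (v : 'cV[R]_n.+1) (y : 'rV[R]_n.+1) :
  (ones R n.+1)^T *m v = 0 -> y *m ones R n.+1 = 0 ->
  lin_span (doubly_stochastic R n.+1) (v *m y).
Proof.
move=> ev ye; apply/span_doublyP; exists 0.
by rewrite -mulmxA ye mulmx0 mulmxA ev mul0mx !scale0r.
Qed.

(** * Vectors, kernels and common eigenvectors *)

Lemma mulmx_cV_eq0 (R : realType) m n (A : 'M[R]_(m, n)) :
  (forall v : 'cV_n, A *m v = 0) -> A = 0.
Proof.
move=> A0; apply/matrixP => i j.
by have /colP/(_ i) := A0 (delta_mx j 0); rewrite -colE !mxE.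
Qed.

Lemma unitmx_ker0 (R : realType) n (P : 'M[R]_n) :
  (forall v : 'cV_n, P *m v = 0 -> v = 0) -> P \in unitmx.
Proof.
move=> kerP; rewrite unitmxE unitfE -det_tr; apply/negP => /det0P[v v0 vP].
case/negP: v0; apply/eqP/trmx_inj; rewrite trmx0; apply: kerP.
by rewrite -[P]trmxK -trmx_mul vP trmx0.
Qed.

(** The rows orthogonal to [ones] separate every vector from the line spanned
    by [ones]: differences of two coordinates suffice. *)
Lemma ones_line_or_separated (R : realType) n (v : 'cV[R]_n.+1) :
  (exists c, v = c *: ones R n.+1) \/
  (exists y : 'rV_n.+1, y *m ones R n.+1 = 0 /\ y *m v = 1%:M).
Proof.
have [[i vi]|v_cst] := pselect (exists i, v i 0 != v ord0 0); last first.
  left; exists (v ord0 0); apply/colP => i; rewrite !mxE mulr1.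
  by apply/eqP/negP => /negP vi; apply: v_cst; exists i.
right; exists ((v i 0 - v ord0 0)^-1 *: (delta_mx 0 i - delta_mx 0 ord0)).
rewrite -!scalemxAl !mulmxBl -!rowE; split.
  by apply/rowP => j; rewrite !mxE subrr mulr0.
apply/rowP => j; rewrite !mxE !ord1 mulVf //= subr_eq0.
exact: vi.
Qed.

(** Applied to [w] outside the line of [ones], the rank-one matrices [v *m y]
    with [y] orthogonal to [ones] produce [v] itself; an eigenvector of all of
    them must therefore be proportional to [v]. *)
Lemma rank1_eigenvector (R : realType) n (v w : 'cV[R]_n.+1) :
  (forall y : 'rV_n.+1, y *m ones R n.+1 = 0 ->
     exists c, v *m y *m w = c *: w) ->
  (exists c, w = c *: ones R n.+1) \/ (exists c, v = c *: w).
Proof.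
have [|[y [ye yw]]] := ones_line_or_separated w; first by left.
by move=> /(_ y ye)[c]; rewrite -mulmxA yw mulmx1 => vw; right; exists c.
Qed.

Lemma linear_cV_mulmx (R : realType) m n (f : 'cV[R]_n -> 'cV[R]_m) :
  {morph f : u v / u + v} -> (forall c, {morph f : v / c *: v}) ->
  exists P : 'M[R]_(m, n), forall v, P *m v = f v.
Proof.
move=> fD fZ; exists (\matrix_(i, j) f (delta_mx j 0) i 0) => v.
have f0 : f 0 = 0 by rewrite -[0](scale0r 0) fZ scale0r.
rewrite [in RHS](matrix_sum_delta v).
rewrite (big_morph f fD f0); apply/colP => i.
rewrite mxE summxE; apply: eq_bigr => j _.
by rewrite big_ord1 fZ !mxE mulrC.
Qed.

(** * Automorphisms *)

Section Automorphism.

Context (R : realType) (n : nat) (Alg : set 'M[R]_n) (phi : 'M[R]_n -> 'M[R]_n).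
Context (aut_phi : alg_automorphism Alg phi).

Lemma aut_stable A : Alg A -> Alg (phi A).
Proof. by case: aut_phi => -[h _ _] _ _ _ _; apply: h. Qed.

Lemma aut_surj B : Alg B -> exists2 A, Alg A & phi A = B.
Proof. by case: aut_phi => -[_ _ h] _ _ _ _ /h. Qed.

Lemma aut_inj A B : Alg A -> Alg B -> phi A = phi B -> A = B.
Proof.
by case: aut_phi => -[_ h _] _ _ _ _ aA aB; apply: h; rewrite inE.
Qed.

Lemma autD A B : Alg A -> Alg B -> phi (A + B) = phi A + phi B.
Proof. by case: aut_phi => _ h _ _ _; apply: h. Qed.

Lemma autZ c A : Alg A -> phi (c *: A) = c *: phi A.
Proof. by case: aut_phi => _ _ h _ _; apply: h. Qed.

Lemma autM A B : Alg A -> Alg B -> phi (A *m B) = phi A *m phi B.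
Proof. by case: aut_phi => _ _ _ h _; apply: h. Qed.

Lemma aut0 : Alg 0 -> phi 0 = 0.
Proof. by move=> /(autZ 0); rewrite !scale0r. Qed.

Lemma aut_separated A : Alg 0 -> Alg A -> A != 0 ->
  exists z : 'cV_n, phi A *m z != 0.
Proof.
move=> a0 aA /eqP A0; apply: contrapT => noz; apply: A0.
apply: aut_inj => //; rewrite aut0 //; apply: mulmx_cV_eq0 => z.
by apply/eqP/negP => /negP zP; apply: noz; exists z.
Qed.

(** The map [v |-> Q v y] carries column vectors into the algebra and commutes
    with left multiplication by [A]; transporting its values by [phi] and
    evaluating at [z] gives a linear map that intertwines [A] with [phi A]. *)
Lemma intertwiner (Q : 'M[R]_n) (y : 'rV[R]_n) (z : 'cV[R]_n) :
  (forall A, Alg A -> Q *m A = A *m Q) ->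
  (forall v : 'cV_n, Alg (Q *m v *m y)) ->
  exists P : 'M[R]_n, (forall v, P *m v = phi (Q *m v *m y) *m z) /\
    (forall A, Alg A -> P *m A = phi A *m P).
Proof.
move=> Qcomm aQ.
have [||P PE] := @linear_cV_mulmx _ _ _ (fun v => phi (Q *m v *m y) *m z).
- by move=> u v; rewrite mulmxDr mulmxDl autD // mulmxDl.
- by move=> c v; rewrite -scalemxAr -scalemxAl autZ // -scalemxAl.
exists P; split=> // A aA; apply/eqP; rewrite -subr_eq0; apply/eqP.
apply: mulmx_cV_eq0 => v; rewrite mulmxBl -!mulmxA !PE.
rewrite (mulmxA (phi A)) -autM //.
by rewrite !mulmxA (Qcomm A aA) subrr.
Qed.

Lemma conj_on_intertwiner (P : 'M[R]_n) : P \in unitmx ->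
  (forall A, Alg A -> P *m A = phi A *m P) -> conj_on Alg phi P.
Proof. by move=> Pu PA; split=> // A /PA ->; rewrite mulmxK. Qed.

End Automorphism.

(** * Automorphisms of the row and column stochastic spans *)

Definition diff_row (R : realType) n (k l : 'I_n) : 'rV[R]_n :=
  delta_mx 0 k - delta_mx 0 l.
Arguments diff_row : clear implicits.

Lemma diff_row_ones (R : realType) n (k l : 'I_n) :
  diff_row R n k l *m ones R n = 0.
Proof.
rewrite mulmxBl -!rowE; apply/rowP => j; rewrite !mxE; exact: subrr.
Qed.

Lemma ones_diff_row (R : realType) n (k l : 'I_n) :
  (ones R n)^T *m (diff_row R n k l)^T = 0.
Proof. by rewrite -trmx_mul diff_row_ones trmx0. Qed.

Lemma mulmx_row_neq0 (R : realType) m n (u : 'cV[R]_m) (y : 'rV[R]_n) :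
  u != 0 -> y != 0 -> u *m y != 0.
Proof.
move=> /eqP u0 /eqP y0; apply/eqP => uy0.
have /matrix0Pn[i [j]] : u != 0 by exact/eqP.
rewrite ord1 => ui.
apply: y0; apply/rowP => k; have /matrixP/(_ i k)/eqP := uy0.
by rewrite !mxE big_ord1 mulf_eq0 (negPf ui) => /eqP ->.
Qed.

Lemma diff_row_neq0 (R : realType) n (k l : 'I_n) : k != l ->
  diff_row R n k l != 0.
Proof.
move=> kl; apply/eqP => /rowP/(_ k)/eqP.
by rewrite !mxE !eqxx (negPf kl) subr0 oner_eq0.
Qed.

(** All of [v *m y] with [y] orthogonal to [ones] lie in the algebra, so the
    intertwiner exists with [Q = 1]. Its kernel is an invariant subspace, hence
    contains [ones] or is zero, and [z] is chosen to prevent the former. As the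
    intertwiner sends [ones] to a common eigenvector of the algebra, it fixes
    the line of [ones]. *)
Lemma row_aut_inner (R : realType) n (phi : 'M[R]_n.+2 -> 'M[R]_n.+2) :
  let Alg := lin_span (row_stochastic R n.+2) in
  alg_automorphism Alg phi -> exists P, Alg P /\ conj_on Alg phi P.
Proof.
move=> Alg aut; set e := ones R n.+2.
have aP (v : 'cV_n.+2) (y : 'rV_n.+2) : y *m e = 0 -> Alg (v *m y).
  by move=> ye; apply/span_rowP; exists 0; rewrite -mulmxA ye mulmx0 scale0r.
pose y := diff_row R n.+2 ord0 (lift ord0 ord0).
have ye : y *m e = 0 by exact: diff_row_ones.
have e0 : e != 0 by exact: ones_neq0.
have y0 : y != 0 by exact: diff_row_neq0.
have a0 : Alg 0 by rewrite -(mul0mx _ y); apply: aP.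
have [z ze] := aut_separated aut a0 (aP e y ye) (mulmx_row_neq0 e0 y0).
have [|v|P [PE PA]] := intertwiner aut (Q := 1%:M) (y := y) z.
- by move=> A _; rewrite mul1mx mulmx1.
- exact: aP.
have Pe0 : P *m e != 0 by rewrite PE mul1mx.
have Pu : P \in unitmx.
  apply: unitmx_ker0 => v Pv; apply: contrapT => v0.
  have [[c vE]|[x [xe xv]]] := ones_line_or_separated v.
    have c0 : c != 0 by apply: contra_notN v0 => /eqP c0; rewrite vE c0 scale0r.
    case/negP: Pe0; have := Pv; rewrite vE -scalemxAr => /eqP.
    by rewrite scaler_eq0 (negPf c0).
  case/negP: Pe0; rewrite -(mulmx1 e) -xv (mulmxA e) mulmxA PA; last exact: aP.
  by rewrite -mulmxA Pv mulmx0.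
exists P; split; last exact: conj_on_intertwiner.
apply/span_rowP; rewrite -/e.
have [x xe|//|[c eE]] := @rank1_eigenvector R n.+1 e (P *m e).
  have [A aA <-] := aut_surj aut (aP e x xe).
  have /span_rowP[c Ae] := aA; exists c.
  by rewrite mulmxA -PA // -mulmxA Ae -scalemxAr.
have c0 : c != 0 by apply: contraNneq e0 => c0; rewrite eE c0 scale0r.
by exists c^-1; rewrite [in RHS]eE scalerA mulVf // scale1r.
Qed.

(** Transposition exchanges the two spans and reverses products twice in
    [A |-> (phi A^T)^T], which is therefore again an automorphism; its
    conjugating matrix is turned back by the inverse transpose. *)
Lemma col_aut_inner (R : realType) n (phi : 'M[R]_n.+2 -> 'M[R]_n.+2) :
  let Alg := lin_span (col_stochastic R n.+2) in
  alg_automorphism Alg phi -> exists P, Alg P /\ conj_on Alg phi P.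
Proof.
move=> Alg aut; pose RAlg := lin_span (row_stochastic R n.+2).
have trP (A : 'M[R]_n.+2) : Alg A^T <-> RAlg A.
  split=> [/span_colP[c cA]|/span_rowP[c Ac]].
    apply/span_rowP; exists c; apply: trmx_inj.
    by rewrite trmx_mul cA linearZ.
  by apply/span_colP; exists c; rewrite -trmx_mul Ac linearZ.
pose psi (A : 'M[R]_n.+2) := (phi A^T)^T.
have psi_aut : alg_automorphism RAlg psi.
  split.
  - split=> [A /trP aA|A B|A aA].
    + by apply/trP; rewrite trmxK; apply: aut_stable aut _ aA.
    + rewrite !inE => /trP aA /trP aB /trmx_inj psiAB.
      by apply/trmx_inj; apply: aut_inj aut _ _ aA aB psiAB.
    + have [B aB BA] := aut_surj aut (iffRL (trP A) aA).
      exists B^T; first by apply/trP; rewrite trmxK.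
      by rewrite /psi trmxK BA trmxK.
  - by move=> A B /trP aA /trP aB; rewrite /psi linearD /= (autD aut) // linearD.
  - by move=> c A /trP aA; rewrite /psi !linearZ /= (autZ aut) // linearZ.
  - by move=> A B /trP aA /trP aB; rewrite /psi trmx_mul (autM aut) // trmx_mul.
  - by rewrite /psi trmx1; case: aut => _ _ _ _ ->; rewrite trmx1.
have [P [/span_rowP[c Pe] [Pu PA]]] := row_aut_inner psi_aut.
exists (invmx P)^T; split.
  have c0 : c != 0.
    apply: contraNneq (ones_neq0 R n.+1) => c0.
    by rewrite -[ones _ _](mulKmx Pu) Pe c0 scale0r mulmx0.
  apply/trP/span_rowP; exists c^-1.
  by rewrite -[in LHS](scalerK c0 (ones R n.+2)) -Pe -scalemxAr mulKmx.
split=> [|A aA]; first by rewrite unitmx_tr unitmx_inv.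
have := PA A^T; rewrite /psi trmxK => /(_ (iffLR (trP _) _)) psiA.
rewrite -[phi A]trmxK psiA ?trmxK // !trmx_mul trmxK.
by rewrite mulmxA trmx_inv invmxK.
Qed.

(** * Automorphisms of the doubly stochastic span *)

(** The averaging matrix spans a one-dimensional ideal, so the columns of its
    image are common eigenvectors of the algebra. Outside the line of [ones]
    there is no such vector: it would be proportional to every vector of zero
    sum, and these form a space of dimension at least 2. This is where the size
    3 enters; for size 2 an automorphism may exchange the two idempotents. *)
Lemma doubly_aut_avg (R : realType) n (phi : 'M[R]_n.+3 -> 'M[R]_n.+3) :
  let Alg := lin_span (doubly_stochastic R n.+3) in
  alg_automorphism Alg phi -> phi (avg_mx R n.+3) = avg_mx R n.+3.
Proof.
move=> Alg aut; set e := ones R n.+3; set J := avg_mx R n.+3.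
have Je : J *m e = e by exact: avg_mx_ones.
have eJ : e^T *m J = e^T by exact: ones_avg_mx.
have aP := @rank1_span_doubly R n.+2.
have aJ : Alg J by apply/span_doublyP; exists 1; rewrite !scale1r.
have a0 : Alg 0.
  by apply/span_doublyP; exists 0; rewrite mulmx0 mul0mx !scale0r.
have J0 : J != 0.
  by apply: contraNneq (ones_neq0 R n.+2) => J0; rewrite -/e -Je J0 mul0mx.
have eigJ A (x : 'cV_n.+3) : Alg A ->
    exists c, A *m (phi J *m x) = c *: (phi J *m x).
  move=> aA; have [B aB <-] := aut_surj aut aA.
  have /span_doublyP[c [Be _]] := aB.
  exists c; rewrite mulmxA -(autM aut) // (mulmx_avg Be) (autZ aut) //.
  by rewrite scalemxAl.
have imJ x : exists c, phi J *m x = c *: e.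
  set w := phi J *m x.
  pose i0 : 'I_n.+3 := ord0; pose i1 := lift i0 ord0.
  pose i2 := lift i0 (lift ord0 ord0) : 'I_n.+3.
  have prop k l : (exists c, w = c *: e) \/
                  (exists c, (diff_row R n.+3 k l)^T = c *: w).
    apply: rank1_eigenvector => y ye; apply: eigJ; apply: aP => //.
    exact: ones_diff_row.
  have [//|[c1 /colP u1]] := prop i0 i1.
  have [//|[c2 /colP u2]] := prop i0 i2.
  (* [u2] is nonzero at [i2] but zero at [i1], which forces [w] to vanish at
     [i1], where [u1] does not. *)
  have := u1 i1; have := u2 i1; have := u2 i2; rewrite !mxE /=.
  move=> c2w2 /esym/eqP; rewrite subr0 mulf_eq0 => /orP[/eqP c20|/eqP ->].
    by move/eqP: c2w2; rewrite c20 mul0r sub0r oppr_eq0 oner_eq0.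
  by move/eqP; rewrite mulr0 sub0r oppr_eq0 oner_eq0.
have JphiJ : J *m phi J = phi J.
  apply/eqP; rewrite -subr_eq0; apply/eqP/mulmx_cV_eq0 => x.
  by rewrite mulmxBl -mulmxA; have [c ->] := imJ x; rewrite -scalemxAr Je subrr.
have /span_doublyP[c [_ ephiJ]] := aut_stable aut aJ.
have phiJ : phi J = c *: J by rewrite -JphiJ; apply: avg_mulmx.
have c0 : c != 0.
  apply: contraNneq J0 => c0; apply/eqP/(aut_inj aut) => //.
  by rewrite (aut0 aut) // phiJ c0 scale0r.
have JJ : J *m J = J by rewrite (@mulmx_avg _ _ J 1) ?scale1r.
have : phi J *m phi J = phi J by rewrite -(autM aut) // JJ.
rewrite phiJ -scalemxAl -scalemxAr JJ scalerA => /eqP.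
rewrite -subr_eq0 -scalerBl scaler_eq0 (negPf J0) orbF -{3}[c]mulr1 -mulrBr.
by rewrite mulf_eq0 (negPf c0) subr_eq0 => /eqP ->; rewrite scale1r.
Qed.

(** Since [phi] fixes the averaging matrix [J], an intertwiner [P0] built on the
    zero-sum vectors (with [Q = 1 - J]) is orthogonal to [J] on both sides and
    invertible on those vectors. Then [J + eps P0] still intertwines for every
    [eps != 0], is invertible, and is doubly stochastic for [eps] small. *)
Lemma doubly_aut_inner (R : realType) n (phi : 'M[R]_n.+3 -> 'M[R]_n.+3) :
  let Alg := lin_span (doubly_stochastic R n.+3) in
  alg_automorphism Alg phi ->
  exists P, doubly_stochastic R n.+3 P /\ conj_on Alg phi P.
Proof.
move=> Alg aut; have phiJ := doubly_aut_avg aut.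
move: phiJ; set e := ones R n.+3; set J := avg_mx R n.+3 => phiJ.
have Je : J *m e = e by exact: avg_mx_ones.
have eJ : e^T *m J = e^T by exact: ones_avg_mx.
have aP := @rank1_span_doubly R n.+2.
have aJ : Alg J by apply/span_doublyP; exists 1; rewrite !scale1r.
have a0 : Alg 0.
  by apply/span_doublyP; exists 0; rewrite mulmx0 mul0mx !scale0r.
have JA A : Alg A -> J *m A = A *m J.
  by move=> /span_doublyP[c [Ae eA]]; rewrite (mulmx_avg Ae) (avg_mulmx eA).
have Jv0 (v : 'cV_n.+3) : J *m v = 0 -> e^T *m v = 0.
  by move=> Jv; rewrite -eJ -mulmxA Jv mulmx0.
have JvP (v : 'cV_n.+3) : e^T *m v = 0 -> J *m v = 0.
  by move=> ev; rewrite /J avg_mxE -scalemxAl -mulmxA ev mulmx0 scaler0.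
pose y := diff_row R n.+3 ord0 (lift ord0 ord0).
have ye : y *m e = 0 by exact: diff_row_ones.
have ey : e^T *m y^T = 0 by exact: ones_diff_row.
have y0 : y != 0 by exact: diff_row_neq0.
have yT0 : y^T != 0 by rewrite trmx_eq0.
have [z ze] := aut_separated aut a0 (aP y^T y ey ye) (mulmx_row_neq0 yT0 y0).
have [A aA|v|P0 [P0E P0A]] := intertwiner aut (Q := 1%:M - J) (y := y) z.
- by rewrite mulmxBl mulmxBr JA // mul1mx mulmx1.
- apply: aP => //.
  by rewrite mulmxA mulmxBr mulmx1 eJ subrr mul0mx.
have P0e : P0 *m e = 0.
  by rewrite P0E mulmxBl mul1mx Je subrr mul0mx (aut0 aut) // mul0mx.
have P0J : P0 *m J = 0.
  by rewrite /J avg_mxE -scalemxAr mulmxA P0e mul0mx scaler0.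
have JP0 : J *m P0 = 0 by rewrite -phiJ -P0A.
have P0y : P0 *m y^T != 0 by rewrite P0E mulmxBl mul1mx JvP // subr0.
have P0inj (v : 'cV_n.+3) : e^T *m v = 0 -> P0 *m v = 0 -> v = 0.
  move=> ev P0v; have [[c vE]|[x [xe xv]]] := ones_line_or_separated v.
    have Jv : J *m v = v by rewrite vE -scalemxAr Je.
    by rewrite -Jv JvP.
  case/negP: P0y; rewrite -(mulmx1 y^T) -xv (mulmxA y^T) mulmxA P0A; last exact: aP.
  by rewrite -mulmxA P0v mulmx0.
have [eps eps_gt0 P_ge0] := avg_perturb_ge0 P0.
have eps0 : eps != 0 by rewrite gt_eqF.
exists (J + eps *: P0); split.
  split=> //; [apply/row_sums1P | apply/col_sums1P].
    by rewrite mulmxDl -(scalemxAl eps) P0e scaler0 addr0.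
  have eP0 : e^T *m P0 = 0 by rewrite -eJ -mulmxA JP0 mulmx0.
  by rewrite mulmxDr -(scalemxAr eps) eP0 scaler0 addr0.
apply: conj_on_intertwiner => [|A aA]; last first.
  have JphiA : J *m A = phi A *m J.
    have /span_doublyP[c [Ae eA]] := aA.
    by rewrite -[in RHS]phiJ -(autM aut) // (mulmx_avg Ae) (avg_mulmx eA)
      (autZ aut) // phiJ.
  by rewrite mulmxDl mulmxDr -(scalemxAl eps) -(scalemxAr eps) P0A // JphiA.
apply: unitmx_ker0 => v; rewrite mulmxDl -(scalemxAl eps) => Pv.
have Jv : J *m v = 0.
  have JJ : J *m J = J by rewrite (@mulmx_avg _ _ J 1) ?scale1r.
  have := congr1 (mulmx J) Pv.
  by rewrite mulmxDr -(scalemxAr eps) !mulmxA JJ JP0 mul0mx scaler0 addr0 mulmx0.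
apply: P0inj; first exact: Jv0.
by move/eqP: Pv; rewrite Jv add0r scaler_eq0 (negPf eps0) => /eqP.
Qed.

(** * The doubly stochastic span of size 2 *)

Lemma sum_ord2 (R : realType) (F : 'I_2 -> R) : \sum_i F i = F 0 + F 1.
Proof.
by rewrite big_ord_recl big_ord1; congr (F _ + F _); apply: val_inj.
Qed.

Lemma mx22_eqP (R : realType) (A : 'M[R]_2) a b c d :
  A 0 0 = a -> A 0 1 = b -> A 1 0 = c -> A 1 1 = d -> A = mx22 a b c d.
Proof.
move=> <- <- <- <-; apply/matrixP => i j; rewrite mxE.
by case: (unliftP ord0 i) => [i'|] -> /=; case: (unliftP ord0 j) => [j'|] -> //=;
  rewrite ?ord1; congr (A _ _); apply: val_inj.
Qed.

Lemma mx22_inj (R : realType) (a b c d a' b' c' d' : R) :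
  mx22 a b c d = mx22 a' b' c' d' -> [/\ a = a', b = b', c = c' & d = d'].
Proof.
by move/matrixP => h; split; [have := h 0 0 | have := h 0 1 | have := h 1 0 |
  have := h 1 1]; rewrite !mxE.
Qed.

Lemma mx22D (R : realType) (a b c d a' b' c' d' : R) :
  mx22 a b c d + mx22 a' b' c' d' = mx22 (a + a') (b + b') (c + c') (d + d').
Proof. by apply: mx22_eqP; rewrite !mxE. Qed.

Lemma mx22Z (R : realType) (k a b c d : R) :
  k *: mx22 a b c d = mx22 (k * a) (k * b) (k * c) (k * d).
Proof. by apply: mx22_eqP; rewrite !mxE. Qed.

Lemma mx22M (R : realType) (a b c d a' b' c' d' : R) :
  mx22 a b c d *m mx22 a' b' c' d' =
  mx22 (a * a' + b * c') (a * b' + b * d') (c * a' + d * c') (c * b' + d * d').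
Proof. by apply: mx22_eqP; rewrite !mxE sum_ord2 !mxE. Qed.

Lemma mx22_1 (R : realType) : 1%:M = mx22 (1 : R) 0 0 1.
Proof. by apply: mx22_eqP; rewrite !mxE. Qed.

Lemma span_doubly2P (R : realType) (A : 'M[R]_2) :
  lin_span (doubly_stochastic R 2) A <-> exists a b, A = mx22 a b b a.
Proof.
split=> [/span_doublyP[c [/colP Ae /rowP eA]]|[a [b ->]]].
  exists (A 0 0), (A 0 1).
  have := Ae 0; have := Ae 1; have := eA 0.
  rewrite !mulmx_ones ones_tr_mulmx !sum_ord2 !mxE mulr1.
  move=> s0 s1 s2.
  have h : A 1 0 = A 0 1 by apply: (addrI (A 0 0)); rewrite s0 s2.
  by apply: mx22_eqP => //; apply: (addrI (A 1 0)); rewrite s1 -s0 addrC.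
apply/span_doublyP; exists (a + b); split.
  by apply/colP => i; rewrite mulmx_ones sum_ord2 !mxE mulr1 /=;
    case: ifP => _ //; rewrite addrC.
by apply/rowP => i; rewrite ones_tr_mulmx sum_ord2 !mxE mulr1 /=;
  case: ifP => _ //; rewrite addrC.
Qed.

Definition is_id2 (R : realType) (phi : 'M[R]_2 -> 'M[R]_2) :=
  forall a b : R, phi (mx22 a b b a) = mx22 a b b a.

Definition is_flip2 (R : realType) (phi : 'M[R]_2 -> 'M[R]_2) :=
  forall a b : R, phi (mx22 a b b a) = mx22 a (- b) (- b) a.

(** The algebra is generated by the swap [S], and the image of [S] is again a
    square root of the identity. In the algebra the only ones are [1],
    [-1], [S] and [-S], and injectivity rules out the first two. *)
Lemma doubly2_aut_id_or_flip (R : realType) (phi : 'M[R]_2 -> 'M[R]_2) :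
  alg_automorphism (lin_span (doubly_stochastic R 2)) phi ->
  is_id2 phi \/ is_flip2 phi.
Proof.
move=> aut.
have aM a b : lin_span (doubly_stochastic R 2) (mx22 a b b a).
  by apply/span_doubly2P; exists a, b.
have phi1 : phi (mx22 1 0 0 1) = mx22 1 0 0 1.
  by rewrite -mx22_1; case: aut.
have /span_doubly2P[x [y phiS]] := aut_stable aut (aM 0 1).
have phiE a b : phi (mx22 a b b a) = mx22 (a + b * x) (b * y) (b * y) (a + b * x).
  have -> : mx22 a b b a = a *: mx22 1 0 0 1 + b *: mx22 0 1 1 0.
    by rewrite !mx22Z mx22D !mulr1 !mulr0 !addr0 !add0r.
  rewrite (autD aut); try by rewrite mx22Z; apply: aM.
  by rewrite !(autZ aut) // phi1 phiS !mx22Z mx22D !mulr1 !mulr0 !add0r.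
have := autM aut (aM 0 1) (aM 0 1).
rewrite mx22M !mulr0 !mul0r !mulr1 !add0r !addr0 phi1 phiS mx22M.
case/mx22_inj => sq cross _ _.
have y0 : y != 0.
  apply/eqP => y0; have /(aut_inj aut (aM 0 1) (aM x 0)) :
      phi (mx22 0 1 1 0) = phi (mx22 x 0 0 x).
    by rewrite !phiE y0 !mul1r !mul0r add0r addr0.
  by case/mx22_inj => _ /eqP; rewrite oner_eq0.
have x0 : x = 0.
  move/esym/eqP: cross; rewrite (mulrC y) -mulr2n mulrn_eq0 /= mulf_eq0.
  by rewrite (negPf y0) orbF => /eqP.
move/esym/eqP: sq; rewrite x0 mul0r add0r -expr2 sqrf_eq1.
case/orP => /eqP y1; [left|right] => a b; rewrite phiE x0 y1 mulr0 addr0.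
  by rewrite mulr1.
by rewrite mulrN1.
Qed.

(** The identity ([s = 1]) and the flip ([s = -1]) are the two sign changes of
    the off-diagonal entry; as [s^2 = 1], such a change is an involution and
    respects the product [(a, b) (c, d) = (a c + b d, a d + b c)]. *)
Lemma doubly2_sign_aut (R : realType) (phi : 'M[R]_2 -> 'M[R]_2) (s : R) :
  s * s = 1 ->
  (forall a b, phi (mx22 a b b a) = mx22 a (s * b) (s * b) a) ->
  alg_automorphism (lin_span (doubly_stochastic R 2)) phi.
Proof.
move=> ss phiE; split.
- split=> [A|A B|A].
  + case/span_doubly2P => a [b ->]; rewrite phiE.
    by apply/span_doubly2P; exists a, (s * b).
  + rewrite !inE => /span_doubly2P[a [b ->]] /span_doubly2P[c [d ->]].
    rewrite !phiE => /mx22_inj[-> sbd _ _].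
    by rewrite -(mul1r b) -ss -mulrA sbd mulrA ss mul1r.
  + case/span_doubly2P => a [b ->].
    exists (mx22 a (s * b) (s * b) a); first by apply/span_doubly2P; exists a, (s * b).
    by rewrite phiE mulrA ss mul1r.
- move=> A B /span_doubly2P[a [b ->]] /span_doubly2P[c [d ->]].
  by rewrite mx22D !phiE mx22D mulrDr.
- move=> c A /span_doubly2P[a [b ->]].
  by rewrite mx22Z !phiE mx22Z mulrCA.
- move=> A B /span_doubly2P[a [b ->]] /span_doubly2P[c [d ->]].
  rewrite !phiE !mx22M (addrC (b * c)) (addrC (b * d)) phiE.
  have -> : s * b * (s * d) = b * d by rewrite mulrACA ss mul1r.
  have -> : s * (a * d + b * c) = a * (s * d) + s * b * c.
    by rewrite mulrDr (mulrCA s a) (mulrA s b).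
  by rewrite (addrC (s * b * c)) (addrC (b * d)).
- by rewrite mx22_1 phiE mulr0.
Qed.

Theorem theorem2p7 (R : realType) :
  (let DS2 := lin_span (doubly_stochastic R 2) in
   let is_id (phi : 'M[R]_2 -> 'M[R]_2) := forall A, DS2 A -> phi A = A in
   let is_flip (phi : 'M[R]_2 -> 'M[R]_2) :=
     forall a b : R, phi (mx22 a b b a) = mx22 a (- b) (- b) a in
   [/\ forall phi, alg_automorphism DS2 phi ->
         exists P : 'M[R]_2, (P = 1%:M \/ P = mx22 1 0 0 (- 1)) /\ conj_on DS2 phi P,
       forall phi, alg_automorphism DS2 phi <-> is_id phi \/ is_flip phi
     & forall phi, is_id phi -> ~ is_flip phi])
  /\
  (forall (n : nat) (hn : (2 <= n)%N) (Alg : set 'M[R]_n)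
      (hAlg : [\/ Alg = lin_span (doubly_stochastic R n),
                  Alg = lin_span (row_stochastic R n)
                | Alg = lin_span (col_stochastic R n)])
      (hcase : n <> 2%N \/ Alg <> lin_span (doubly_stochastic R n))
      (phi : 'M[R]_n -> 'M[R]_n) (hphi : alg_automorphism Alg phi),
    (exists P : 'M[R]_n, Alg P /\ conj_on Alg phi P)
    /\ (Alg = lin_span (doubly_stochastic R n) ->
        exists P : 'M[R]_n, doubly_stochastic R n P /\ conj_on Alg phi P)).
Proof.
split.
  have idP phi : (forall A, lin_span (doubly_stochastic R 2) A -> phi A = A) <->
                 is_id2 phi.
    split=> [idphi a b|idphi A /span_doubly2P[a [b ->]] //].
    by apply: idphi; apply/span_doubly2P; exists a, b.
  split=> [phi aut|phi|phi idphi flip].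
  - have [idphi|flip] := doubly2_aut_id_or_flip aut.
      exists 1%:M; split; first by left.
      split=> [|A /(iffRL (idP phi) idphi) ->]; first exact: unitmx1.
      by rewrite invmx1 mul1mx mulmx1.
    exists (mx22 1 0 0 (- 1)); split; first by right.
    apply: conj_on_intertwiner => [|A /span_doubly2P[a [b ->]]].
      have /mulmx1_unit[] // : mx22 1 0 0 (- 1) *m mx22 1 0 0 (- 1) = 1%:M :> 'M[R]_2.
      by rewrite mx22M mx22_1 !mulr0 !mul0r mulrNN !mulr1 !addr0 !add0r.
    by rewrite flip !mx22M !(mul0r, mulr0, mul1r, mulr1, addr0, add0r, mulN1r,
      mulrN1, opprK).
  - split=> [/doubly2_aut_id_or_flip|].
      by case=> [/idP|flip]; [left | right].
    case=> [/idP idphi|flip].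
      by apply: (@doubly2_sign_aut _ _ 1) => [|a b]; rewrite ?mul1r.
    by apply: (@doubly2_sign_aut _ _ (-1)) => [|a b]; rewrite ?mulrNN ?mulr1 ?mulN1r.
  - have := flip 0 1; rewrite (iffLR (idP phi) idphi) => /mx22_inj[_ /eqP].
    by rewrite -subr_eq0 opprK -(natrD _ 1 1) pnatr_eq0.
move=> n hn Alg hAlg hcase phi hphi.
have doubly : Alg = lin_span (doubly_stochastic R n) ->
    exists P, doubly_stochastic R n P /\ conj_on Alg phi P.
  move=> AlgE; case: hcase => [n2|/(_ AlgE)//].
  case: n hn Alg hAlg phi hphi AlgE n2 => [|[|[|n]]] // _ Alg _ phi aut AlgE _.
  by rewrite AlgE in aut *; apply: doubly_aut_inner.
split=> //; case: hAlg => AlgE.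
- have [P [dP cP]] := doubly AlgE; exists P; split=> //.
  by rewrite AlgE; apply: sub_lin_span.
- case: n hn Alg {hcase doubly} phi hphi AlgE => [|[|n]] // _ Alg phi aut AlgE.
  by rewrite AlgE in aut *; apply: row_aut_inner.
- case: n hn Alg {hcase doubly} phi hphi AlgE => [|[|n]] // _ Alg phi aut AlgE.
  by rewrite AlgE in aut *; apply: col_aut_inner.
Qed.
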